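(* Let $A_1,\dots,A_m, C$ be real symmetric $n\times n$ matrices and $b\in\mathbb{R}^m$. Assume that the semidefinite program $$(P)\qquad \inf\ \langle C,X\rangle\quad\text{s.t.}\quad \langle A_i,X\rangle=b_i\ (i=1,\dots,m),\quad X\succeq 0$$ is feasible. Consider the optimization problem $$(D_{\rm Ram})\qquad \sup\ \langle b,y\rangle$$ over $y\in\mathbb{R}^m$, $y^1,\dots,y^{n-1}\in\mathbb{R}^m$ and symmetric matrices $U_0,\dots,U_{n-1},V_0,\dots,V_{n-1}$ of order $n$, subject to $$C-\mathcal{A}^*y\in\mathcal{S}^n_++\tan(U_{n-1}),\qquad U_0=V_0=0,$$ and, for $i=1,\dots,n-1$, $$\mathcal{A}^*y^i=U_i+V_i,\qquad \langle b,y^i\rangle=0,\qquad U_i\in\mathcal{S}^n_+,\qquad V_i\in\tan(U_{i-1}).$$ Then the optimal values of $(P)$ and $(D_{\rm Ram})$ are equal, and the optimal value of $(D_{\rm Ram})$ is attained when it is finite.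
   Context: $\mathcal{S}^n$ is the set of real symmetric $n\times n$ matrices and $\mathcal{S}^n_+$ the set of positive semidefinite (psd) ones; $X\succeq0$ means $X$ is psd. For symmetric matrices $\langle S,T\rangle=\mathrm{trace}(ST)$; for vectors $\langle b,y\rangle=b^\top y$. The operator $\mathcal{A}:\mathcal{S}^n\to\mathbb{R}^m$ is $\mathcal{A}X=(\langle A_1,X\rangle,\dots,\langle A_m,X\rangle)^\top$, with adjoint $\mathcal{A}^*y=\sum_{i=1}^m y_iA_i$. For $U\in\mathcal{S}^n_+$, $$\tan(U)=\Bigl\{W+W^\top : W\in\mathbb{R}^{n\times n},\ \begin{pmatrix} U & W \\ W^\top & R \end{pmatrix}\in\mathcal{S}^{2n}_+\ \text{for some } R\in\mathcal{S}^n_+\Bigr\}.$$ The sum of sets is the Minkowski sum. Optimal values are in $\mathbb{R}\cup\{\pm\infty\}$, with the supremum over an empty set equal to $-\infty$. The $y^i$ are vectors (superscripts are indices), while $y_i$ denotes the $i$th component of $y$. *)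

(* Defs.v *)
From mathcomp Require Export all_boot all_order all_algebra.
From mathcomp Require Export all_classical all_reals ereal.

Set Implicit Arguments.
Unset Strict Implicit.
Unset Printing Implicit Defensive.

Import Order.TTheory GRing.Theory Num.Theory.

Local Open Scope classical_set_scope.
Local Open Scope ring_scope.

Section SemidefiniteProgramming.
Variable R : realType.

Definition psd (n : nat) : set 'M[R]_n :=
  [set X | X \is symmetricmx /\ forall x : 'cV[R]_n, 0 <= (x^T *m X *m x) 0 0].

Definition mxdot (n : nat) (S T : 'M[R]_n) : R := \tr (S *m T).

Definition vdot (m : nat) (b y : 'cV[R]_m) : R := (b^T *m y) 0 0.

Definition Aop (m n : nat) (A : 'I_m -> 'M[R]_n) (X : 'M[R]_n) : 'cV[R]_m :=
  \col_i mxdot (A i) X.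

Definition Aadj (m n : nat) (A : 'I_m -> 'M[R]_n) (y : 'cV[R]_m) : 'M[R]_n :=
  \sum_i y i 0 *: A i.

Definition tan_psd (n : nat) (U : 'M[R]_n) : set 'M[R]_n :=
  [set W + W^T | W in
    [set W | exists2 R0, psd R0 & psd (block_mx U W W^T R0)]].

Definition primal_feasible (m n : nat) (A : 'I_m -> 'M[R]_n) (b : 'cV[R]_m)
    : set 'M[R]_n :=
  [set X | Aop A X = b /\ psd X].

Definition primal_value (m n : nat) (A : 'I_m -> 'M[R]_n) (b : 'cV[R]_m)
    (C : 'M[R]_n) : \bar R :=
  ereal_inf [set (mxdot C X)%:E | X in primal_feasible A b].

(* The matrices have order n.+1, so U and V are indexed by 0, ..., n and the
   vectors y^1, ..., y^n are ys 0, ..., ys (n - 1): for i : 'I_n, y^(i+1) is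
   ys i, U_(i+1) is U (lift ord0 i) and U_i is U (widen_ord (leqnSn n) i). *)
Definition ramana_feasible (m n : nat) (A : 'I_m -> 'M[R]_n.+1)
    (b : 'cV[R]_m) (C : 'M[R]_n.+1) (y : 'cV[R]_m)
    (ys : 'I_n -> 'cV[R]_m) (U V : 'I_n.+1 -> 'M[R]_n.+1) : Prop :=
  [/\ forall i, U i \is symmetricmx /\ V i \is symmetricmx,
      [set S + T | S in @psd n.+1 & T in tan_psd (U ord_max)] (C - Aadj A y),
      U ord0 = 0 /\ V ord0 = 0 &
      forall i : 'I_n,
        [/\ Aadj A (ys i) = U (lift ord0 i) + V (lift ord0 i),
            vdot b (ys i) = 0,
            psd (U (lift ord0 i)) &
            tan_psd (U (widen_ord (leqnSn n) i)) (V (lift ord0 i))]].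

Definition ramana_value (m n : nat) (A : 'I_m -> 'M[R]_n.+1)
    (b : 'cV[R]_m) (C : 'M[R]_n.+1) : \bar R :=
  ereal_sup [set (vdot b y)%:E | y in
    [set y | exists ys U V, ramana_feasible A b C y ys U V]].

End SemidefiniteProgramming.

(* Main.v *)
Require Import Defs.
From mathcomp Require Import all_boot all_order all_algebra.
From mathcomp Require Import all_classical all_reals ereal.
From mathcomp Require Import ring lra.

(** Weak duality.  Let [X] be primal feasible.  By induction, [U_i X = 0]: an
    element of [tan U] pairs to zero with every psd [X] such that [U X = 0], so
    [<U_i, X> = <A^* y^i, X> = <b, y^i> = 0], and two psd matrices with zero
    inner product have zero product.  Hence the tangent part of [C - A^* y]
    contributes nothing to [<C, X> - <b, y>], which is therefore nonnegative
    ([chain_annihilates], [certificate_bound]).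

    Strong duality.  The [U_i] record facial reduction: [U] exposes the face
    [{X psd | U X = 0}] of the psd cone, which contains the feasible set.  Let
    [P] be the orthogonal projector onto the kernel of [U].  A symmetric [M]
    lies in [S_+ + tan U] as soon as [P M P] is psd
    ([psd_add_tan_compression]), so on this face all matrices may be replaced by
    their compressions.  A theorem of alternatives ([sdp_alternative]) says
    that, when the primal value [v] is finite, the compressed program either has
    a dual solution of value at least [v], or admits [y] with [<b, y> = 0] and
    [D = P (A^* y) P] psd and nonzero.
    In the first case the Ramana dual reaches [v], the remaining steps being
    filled with [y = 0] ([chain_pad]).  In the second case
    [U' = D + (1 - P)] is a legitimate next matrix and its rank exceeds that of
    [U] ([rank_face_step]).

    The count of steps: in order [n + 1], after [n] reductions the kernel of [U]
    has dimension at most one.  A further direction would make [U'] positive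
    definite, so that [0] is the only feasible matrix and [v <= 0]; but then
    multiples of that direction already give dual points of value [0] on the
    face exposed by [U] ([certified_at_order]).

    The theorem of alternatives comes from separating [0] from a finite
    dimensional convex cone that need not be closed.  The separating hyperplane
    must not contain the cone, and this is obtained by extending a functional
    from the line of an order unit one dimension at a time
    ([cone_extension]). *)

Import Order.TTheory GRing.Theory Num.Theory.

Local Open Scope classical_set_scope.
Local Open Scope ring_scope.

(** * Positive semidefinite matrices *)

Section PositiveSemidefinite.
Set Implicit Arguments.
Unset Strict Implicit.
Variable R : realType.

Lemma symmxP n (X : 'M[R]_n) : X \is symmetricmx <-> X^T = X.
Proof.
split=> [/is_hermitianmxP {2}->|XE]; first by rewrite expr0 scale1r map_mx_id.
by apply/is_hermitianmxP; rewrite expr0 scale1r map_mx_id.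
Qed.

Lemma trmxD p n (X Y : 'M[R]_(p, n)) : (X + Y)^T = X^T + Y^T.
Proof. exact: linearD. Qed.

Lemma trmxB p n (X Y : 'M[R]_(p, n)) : (X - Y)^T = X^T - Y^T.
Proof. exact: linearB. Qed.

Lemma trmxZ p n (a : R) (X : 'M[R]_(p, n)) : (a *: X)^T = a *: X^T.
Proof. exact: linearZ. Qed.

Lemma mxtrace_trmulE p n (B : 'M[R]_(p, n)) :
  \tr (B^T *m B) = \sum_i \sum_j B j i ^+ 2.
Proof.
by apply: eq_bigr => i _; rewrite mxE; apply: eq_bigr => j _; rewrite mxE expr2.
Qed.

Lemma mxtrace_trmul_ge0 p n (B : 'M[R]_(p, n)) : 0 <= \tr (B^T *m B).
Proof.
rewrite mxtrace_trmulE sumr_ge0 // => i _; rewrite sumr_ge0 // => j _.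
exact: sqr_ge0.
Qed.

Lemma mxtrace_trmul_eq0 p n (B : 'M[R]_(p, n)) : \tr (B^T *m B) = 0 -> B = 0.
Proof.
rewrite mxtrace_trmulE => /eqP; rewrite psumr_eq0; last first.
  by move=> i _; rewrite sumr_ge0 // => j _; rewrite sqr_ge0.
move=> /allP B0; apply/matrixP => i j; rewrite mxE.
have /= := B0 j (mem_index_enum _); rewrite psumr_eq0; last first.
  by move=> k _; rewrite sqr_ge0.
by move=> /allP /(_ i (mem_index_enum _)); rewrite /= sqrf_eq0 => /eqP.
Qed.

Lemma trmul_eq0 p n (B : 'M[R]_(p, n)) : B^T *m B = 0 -> B = 0.
Proof. by move=> B0; apply: mxtrace_trmul_eq0; rewrite B0 mxtrace0. Qed.

Lemma psd_sym n (X : 'M[R]_n) : psd X -> X^T = X.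
Proof. by case=> /symmxP. Qed.

Lemma psd_gram p n (B : 'M[R]_(p, n)) : psd (B^T *m B).
Proof.
split; first by apply/symmxP; rewrite trmx_mul trmxK.
move=> x; rewrite mulmxA -mulmxA -trmx_mul.
by have := mxtrace_trmul_ge0 (B *m x); rewrite trace_mx11.
Qed.

Lemma psd0 n : psd (0 : 'M[R]_n).
Proof. by have := psd_gram (0 : 'M[R]_n); rewrite mulmx0. Qed.

Lemma psdD n (X Y : 'M[R]_n) : psd X -> psd Y -> psd (X + Y).
Proof.
move=> pX pY; split; first by apply/symmxP; rewrite trmxD !psd_sym.
by move=> x; rewrite mulmxDr mulmxDl mxE addr_ge0 //; [case: pX|case: pY].
Qed.

Lemma psdZ n (a : R) (X : 'M[R]_n) : 0 <= a -> psd X -> psd (a *: X).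
Proof.
move=> a0 pX; split; first by apply/symmxP; rewrite trmxZ psd_sym.
by move=> x; rewrite -scalemxAr -scalemxAl mxE mulr_ge0 //; case: pX.
Qed.

Lemma psd_congr p n (X : 'M[R]_p) (M : 'M[R]_(p, n)) :
  psd X -> psd (M^T *m X *m M).
Proof.
move=> pX; split.
  by apply/symmxP; rewrite !trmx_mul trmxK psd_sym // mulmxA.
move=> x; have [_ /(_ (M *m x))] := pX.
by rewrite trmx_mul !mulmxA.
Qed.

Lemma psd_scalar n (a : R) : 0 <= a -> psd (a%:M : 'M[R]_n).
Proof.
move=> a0; rewrite -scalemx1; apply: psdZ => //.
by have := psd_gram (1%:M : 'M[R]_n); rewrite trmx1 mulmx1.
Qed.

Lemma entryE n (X : 'M[R]_n) i j :
  X i j = ((delta_mx i 0 : 'cV_n)^T *m X *m (delta_mx j 0 : 'cV_n)) 0 0.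
Proof. by rewrite trmx_delta -rowE -colE !mxE. Qed.

Lemma psd_diag_ge0 n (X : 'M[R]_n) i : psd X -> 0 <= X i i.
Proof. by case=> _ pX; rewrite entryE. Qed.

Lemma qformDZ n (X : 'M[R]_n) (s : R) (x y : 'cV[R]_n) :
  ((s *: x + y)^T *m X *m (s *: x + y)) 0 0 =
  s ^+ 2 * (x^T *m X *m x) 0 0 +
  s * ((x^T *m X *m y) 0 0 + (y^T *m X *m x) 0 0) + (y^T *m X *m y) 0 0.
Proof.
rewrite trmxD trmxZ !mulmxDl !mulmxDr -!(scalemxAl, scalemxAr).
move: (_ *m _ *m _) (_ *m _ *m _) (_ *m _ *m _) (_ *m _ *m _) => u1 u2 u3 u4.
by rewrite !mxE; ring.
Qed.

(** When [X i i = 0] the form at [s e_i + e_j] is affine in [s], with slope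
    [2 X i j]; being nonnegative for all [s], it is constant. *)
Lemma psd_diag_eq0 n (X : 'M[R]_n) i j : psd X -> X i i = 0 -> X i j = 0.
Proof.
move=> pX Xii0.
have Xji : X j i = X i j by rewrite -{1}(psd_sym pX) mxE.
have h s : 0 <= 2 * s * X i j + X j j.
  have [_ /(_ (s *: delta_mx i 0 + delta_mx j 0))] := pX.
  rewrite qformDZ -!entryE Xii0 Xji mulr0 add0r.
  by rewrite -mulr2n mulrnAr -mulrnAl -mulr_natl.
apply/eqP/negPn/negP => Xij0.
have := h (- (X j j + 1) / (2 * X i j)).
have -> : 2 * (- (X j j + 1) / (2 * X i j)) * X i j = - (X j j + 1) by field.
by lra.
Qed.

(** Symmetric Gaussian elimination: as long as some diagonal entry [X i i] is
    positive, [X] splits into the rank-one term [v v^T / X i i], where [v] is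
    the [i]-th column, and the Schur complement, which is a congruence of [X]
    and has fewer nonzero diagonal entries. *)
Lemma psd_gramP n (X : 'M[R]_n) :
  psd X -> exists p (B : 'M[R]_(p, n)), X = B^T *m B.
Proof.
have [N] := ubnP #|[pred i | X i i != 0]|; elim: N X => // N IH X ltN pX.
case: (pickP [pred i | X i i != 0]) => [i /= Xi0 | Xd0]; last first.
  exists n, 0; rewrite mulmx0; apply/matrixP => i j; rewrite mxE.
  by apply: psd_diag_eq0 => //; apply/eqP; have /negbFE := Xd0 i.
have Xi_gt0 : 0 < X i i by rewrite lt_def Xi0 psd_diag_ge0.
pose e : 'cV[R]_n := delta_mx i 0; pose v := X *m e; pose a := X i i.
have vT : v^T = e^T *m X by rewrite trmx_mul psd_sym.
have eXe : e^T *m X *m e = a%:M.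
  by rewrite [LHS]mx11_scalar -entryE.
pose M : 'M[R]_n := 1%:M - a^-1 *: (e *m v^T).
have MXM : M^T *m X *m M = X - a^-1 *: (v *m v^T).
  rewrite /M trmxB trmxZ trmx1 trmx_mul trmxK mulmxBl mul1mx !mulmxBr !mulmx1.
  rewrite -!(scalemxAl, scalemxAr).
  have -> : v *m e^T *m X = v *m v^T by rewrite vT mulmxA.
  rewrite mulmxBl -scalemxAl.
  have -> : X *m (e *m v^T) = v *m v^T by rewrite mulmxA.
  have -> : v *m v^T *m (e *m v^T) = a *: (v *m v^T).
    by rewrite mulmxA -(mulmxA v) vT eXe mul_mx_scalar -scalemxAl.
  rewrite (scalerA _ a) mulVf // scale1r.
  by rewrite subrr scaler0 subr0.
have := psd_congr M pX; rewrite MXM => pX'.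
have vE j : v j 0 = X j i by rewrite /v -colE mxE.
have X'd j : (X - a^-1 *: (v *m v^T)) j j = X j j - a^-1 * X j i ^+ 2.
  rewrite -vE; move: v {vT MXM pX' vE M} => v.
  by rewrite !mxE big_ord1 !mxE expr2.
(* [X' i i = 0], and zero diagonal entries of [X] stay zero. *)
have [|p [B X'E]] := IH _ _ pX'.
  rewrite -ltnS; apply: leq_trans ltN; rewrite ltnS; apply: proper_card.
  apply/properP; split; last first.
    exists i; rewrite ?inE //= X'd -/a expr2 mulKf // subrr eqxx //.
  apply/fintype.subsetP => j; rewrite !inE X'd; apply: contraNneq => Xjj0.
  by rewrite Xjj0 (psd_diag_eq0 i pX Xjj0) expr0n mulr0 subr0.
exists (p + 1)%N, (col_mx B (Num.sqrt a^-1 *: v^T)).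
rewrite tr_col_mx mul_row_col -X'E trmxZ trmxK -scalemxAl -scalemxAr scalerA.
by rewrite -expr2 sqr_sqrtr ?subrK // invr_ge0 ltW.
Qed.

Lemma psd_mxdot_ge0 n (S X : 'M[R]_n) : psd S -> psd X -> 0 <= mxdot S X.
Proof.
move=> pS /psd_gramP[p [B ->]]; rewrite /mxdot mulmxA mxtrace_mulC mulmxA.
rewrite sumr_ge0 // => i _; apply: psd_diag_ge0.
by have := psd_congr B^T pS; rewrite trmxK.
Qed.

(** With [S = G^T G] and [X = B^T B] the inner product is the squared
    Frobenius norm of [G B^T]. *)
Lemma psd_mxdot_eq0 n (S X : 'M[R]_n) :
  psd S -> psd X -> mxdot S X = 0 -> S *m X = 0.
Proof.
move=> /psd_gramP[q [G ->]] /psd_gramP[p [B ->]].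
rewrite /mxdot mulmxA mxtrace_mulC -mulmxA => GB0.
have : \tr ((G *m B^T)^T *m (G *m B^T)) = 0.
  by rewrite -GB0 trmx_mul trmxK !mulmxA.
by move=> /mxtrace_trmul_eq0 GB; rewrite mulmxA -(mulmxA G^T) GB mulmx0 mul0mx.
Qed.

(** The form of [S] is at most [\sum_ij |S i j|] times the squared norm, since
    [2 |x_i x_j| <= x_i^2 + x_j^2]. *)
Lemma psd_scalar_sub n (S : 'M[R]_n) :
  S^T = S -> exists2 s : R, 0 < s & psd (s%:M - S).
Proof.
move=> symS; pose s := \sum_i \sum_j `|S i j|.
have s0 : 0 <= s by rewrite !sumr_ge0 // => i _; rewrite sumr_ge0.
exists (s + 1); first by lra.
split; first by apply/symmxP; rewrite trmxB tr_scalar_mx symS.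
move=> x; set q := (x^T *m x) 0 0.
have qE : q = \sum_i x i 0 ^+ 2.
  by rewrite /q mxE; apply: eq_bigr => i _; rewrite mxE expr2.
have q0 : 0 <= q by rewrite qE sumr_ge0 // => i _; rewrite sqr_ge0.
have leq i : x i 0 ^+ 2 <= q.
  rewrite qE (bigD1 i) //= lerDl sumr_ge0 // => j _; exact: sqr_ge0.
have entryB (Y Z : 'M[R]_1) : (Y - Z) 0 0 = Y 0 0 - Z 0 0 by rewrite !mxE.
have entryZ a (Y : 'M[R]_1) : (a *: Y) 0 0 = a * Y 0 0 by rewrite mxE.
rewrite mulmxBr mulmxBl mul_mx_scalar -scalemxAl entryB entryZ -/q.
rewrite subr_ge0; apply: (@le_trans _ _ (s * q)); last first.
  by rewrite mulrDl mul1r lerDl.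
rewrite mxE /s exchange_big /= mulr_suml; apply: ler_sum => j _.
rewrite mxE !mulr_suml; apply: ler_sum => i _; rewrite mxE.
have : `|S i j * (x i 0 * x j 0)| <= `|S i j| * q.
  rewrite normrM ler_wpM2l //.
  have := leq i; have := leq j; rewrite ler_norml.
  move: (x i 0) (x j 0) => y z; nra.
by move=> /(le_trans (ler_norm _)); rewrite mulrCA mulrA.
Qed.

(** It suffices to bound [U] below by a positive multiple of [I].  Choose [s]
    with [s I - U^-1] psd; adding this matrix to the psd matrix
    [(s I - U^-1) U (s I - U^-1) = s^2 U - 2 s I + U^-1] leaves
    [s^2 U - s I]. *)
Lemma psd_unit_dominates n (U S : 'M[R]_n) :
  psd U -> U \in unitmx -> S^T = S -> exists t : R, psd (t *: U - S).
Proof.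
move=> pU uU symS; pose V := invmx U.
have symV : V^T = V by rewrite /V trmx_inv psd_sym.
have [s s0 psV] := psd_scalar_sub symV.
have [r r0 prS] := psd_scalar_sub symS.
have pU' : psd (s ^+ 2 *: U - s%:M).
  have -> : s ^+ 2 *: U - s%:M = (s%:M - V)^T *m U *m (s%:M - V) + (s%:M - V).
    rewrite trmxB tr_scalar_mx symV mulmxBl mul_scalar_mx /V mulVmx // mulmxBr.
    rewrite mul_mx_scalar mulmxBl -scalemxAl mulmxV // mul1mx scalerBr scalerA.
    by rewrite scalemx1 -expr2 subrK.
  by apply: psdD => //; apply: psd_congr.
exists (r / s * s ^+ 2).
have -> : (r / s * s ^+ 2) *: U - S =
    (r / s) *: (s ^+ 2 *: U - s%:M) + (r%:M - S).
  by rewrite scalerBr scalerA scale_scalar_mx divfK ?gt_eqF // addrA subrK.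
by apply: psdD => //; apply: psdZ => //; rewrite divr_ge0 ?ltW.
Qed.

End PositiveSemidefinite.

(** * Separation of cones *)

Section Separation.
Set Implicit Arguments.
Unset Strict Implicit.
Variable R : realType.

(** The induction adds one vector [w] to the span at a time.  The value [c] at
    [w] must lie above all [- f m] with [m + w] in [K] and below all [f m] with
    [m - w] in [K]; adding members of the two kinds shows that the former are
    below the latter, and because [u] is an order unit of [K] both kinds occur
    as soon as one does. *)
Lemma cone_extension (V : lmodType R) (K : set V) (u : V) (e : nat -> V)
    (d : nat) :
  (forall x y, K x -> K y -> K (x + y)) ->
  (forall a x, 0 < a -> K x -> K (a *: x)) ->
  (forall a, K (a *: u) -> 0 <= a) ->
  (forall y, K y -> exists t, K (t *: u - y)) ->
  exists g : nat -> R, forall a (x : nat -> R),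
    K (a *: u + \sum_(i < d) x i *: e i) -> 0 <= a + \sum_(i < d) x i * g i.
Proof.
move=> KD KZ Ku Kunit; elim: d => [|d [g gP]].
  by exists (fun=> 0) => a x; rewrite !big_ord0 !addr0 => /Ku.
pose w := e d; pose f a (x : nat -> R) := a + \sum_(i < d) x i * g i.
pose p a (x : nat -> R) := a *: u + \sum_(i < d) x i *: e i.
pose lo := [set r | exists a x, K (p a x + w) /\ r = - f a x].
pose up := [set r | exists a x, K (p a x - w) /\ r = f a x].
have pD a x a' x' : p a x + p a' x' = p (a + a') (fun i => x i + x' i).
  rewrite /p addrACA -scalerDl -big_split; congr (_ + _).
  by apply: eq_bigr => i _; rewrite scalerDl.
have fD a x a' x' : f a x + f a' x' = f (a + a') (fun i => x i + x' i).
  rewrite /f addrACA -big_split; congr (_ + _).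
  by apply: eq_bigr => i _; rewrite mulrDl.
have pZ r a x : r *: p a x = p (r * a) (fun i => r * x i).
  rewrite /p scalerDr scalerA scaler_sumr; congr (_ + _).
  by apply: eq_bigr => i _; rewrite scalerA.
have fZ r a x : r * f a x = f (r * a) (fun i => r * x i).
  rewrite /f mulrDr mulr_sumr; congr (_ + _).
  by apply: eq_bigr => i _; rewrite mulrA.
have lo_up l r : lo l -> up r -> l <= r.
  move=> [a [x [Kl ->]]] [a' [x' [Kr ->]]]; rewrite -subr_ge0 opprK addrC.
  have := KD _ _ Kl Kr; rewrite addrACA subrr addr0 pD => /gP.
  by rewrite fD.
have tuB t a x : t *: u - p a x = p (t + -1 * a) (fun i => 0 + -1 * x i).
  rewrite -pD -pZ scaleN1r; congr (_ - _).
  by rewrite /p big1 ?addr0 // => i _; rewrite scale0r.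
have up_lo : up !=set0 -> lo !=set0.
  move=> [_ [a [x [/Kunit[t Kt] _]]]]; rewrite opprB addrA addrAC tuB in Kt.
  by eexists; eexists; eexists; split; [exact: Kt|].
have lo_up_ex : lo !=set0 -> up !=set0.
  move=> [_ [a [x [/Kunit[t Kt] _]]]]; rewrite opprD addrA tuB in Kt.
  by eexists; eexists; eexists; split; [exact: Kt|].
exists (fun i => if i == d then sup lo else g i) => a x.
rewrite !big_ord_recr /= eqxx !addrA.
have -> : a + \sum_(i < d) x i * (if i == d :> nat then sup lo else g i) =
    f a x.
  by congr (_ + _); apply: eq_bigr => i _; rewrite (ltn_eqF (ltn_ord i)).
rewrite -/(p a x) -/w => Kx.
have [xd|xd|xd] := ltgtP (x d) 0; last first.
- by rewrite xd mul0r addr0; apply: gP; rewrite xd scale0r addr0 in Kx.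
- have lx : lo (- ((x d)^-1 * f a x)).
    rewrite fZ; eexists; eexists; split; last reflexivity.
    have := KZ (x d)^-1 _ _ Kx; rewrite scalerDr pZ scalerA mulVf ?gt_eqF //.
    by rewrite scale1r; apply; rewrite invr_gt0.
  have lo_sup : has_sup lo.
    split; first by exists (- ((x d)^-1 * f a x)).
    by have [r ur] := lo_up_ex (ex_intro _ _ lx); exists r => l /lo_up; apply.
  have := ub_le_sup (proj2 lo_sup) lx.
  rewrite lerNl -(ler_pM2l xd) mulrN mulVKf ?gt_eqF // lerNl.
  by rewrite -subr_ge0 opprK addrC.
- have ux : up ((- x d)^-1 * f a x).
    rewrite fZ; eexists; eexists; split; last reflexivity.
    have := KZ (- x d)^-1 _ _ Kx; rewrite scalerDr pZ scalerA.
    have -> : (- x d)^-1 * x d = -1 by rewrite invrN mulNr mulVf ?lt_eqF.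
    rewrite scaleN1r; apply.
    by rewrite invr_gt0 oppr_gt0.
  have := @ge_sup _ lo _ (up_lo (ex_intro _ _ ux))
    (fun l ll => lo_up _ _ ll ux).
  have Nxd : 0 < - x d by rewrite oppr_gt0.
  by rewrite -(ler_pM2l Nxd) mulVKf ?gt_eqF // mulNr -subr_ge0 opprK.
Qed.

Lemma vdotE m (b y : 'cV[R]_m) : vdot b y = \sum_i b i 0 * y i 0.
Proof. by rewrite /vdot mxE; apply: eq_bigr => i _; rewrite mxE. Qed.

(** Normalizing at the order unit [u] makes the separation proper: the
    hyperplane misses [u], hence cannot contain the cone, even when the cone is
    neither closed nor full-dimensional. *)
Lemma cone_separation d (K : set 'cV[R]_d) (u : 'cV[R]_d) :
  (forall x y, K x -> K y -> K (x + y)) ->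
  (forall a x, 0 < a -> K x -> K (a *: x)) ->
  (forall a, K (a *: u) -> 0 <= a) ->
  K u -> (forall y, K y -> exists t, K (t *: u - y)) ->
  exists g : 'cV[R]_d, (forall y, K y -> 0 <= vdot g y) /\ vdot g u = 1.
Proof.
move=> KD KZ Ku0 Ku Kunit.
pose e i : 'cV[R]_d := \col_j ((j : nat) == i)%:R.
have [g gP] := @cone_extension _ K u e d KD KZ Ku0 Kunit.
pose h : 'cV[R]_d := \col_i g i.
(* Extension of [a u |-> a] to the whole space, as a condition on [h] that
   holds for every decomposition [a u + y] of a member of [K]. *)
have hP a y : K (a *: u + y) -> 0 <= a + vdot h y.
  move=> Ky; pose x i := oapp (fun j => y j 0) 0 (insub i : option 'I_d).
  have xE (i : 'I_d) : x i = y i 0 by rewrite /x valK.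
  have -> : vdot h y = \sum_(i < d) x i * g i.
    by rewrite vdotE; apply: eq_bigr => i _; rewrite mxE xE mulrC.
  apply: gP; move: Ky; congr (K (_ + _)); apply/matrixP => i j.
  rewrite ord1 summxE (bigD1 i) //= big1 ?addr0 => [|k ki].
    by rewrite !mxE eqxx mulr1 xE.
  by rewrite !mxE (_ : (i : nat) == k = false) ?mulr0 // eq_sym; apply/negbTE.
exists h; split=> [y Ky|].
  by have := hP 0 y; rewrite scale0r !add0r; apply.
(* The decompositions [u = (1 - t) u + t u], for all [t], force [<h, u> = 1]. *)
have vZ t : vdot h (t *: u) = t * vdot h u by rewrite /vdot -scalemxAr mxE.
have {}hP t : 0 <= 1 + t * (vdot h u - 1).
  have -> : 1 + t * (vdot h u - 1) = 1 - t + vdot h (t *: u).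
    by rewrite vZ; ring.
  by apply: hP; rewrite -scalerDl subrK scale1r.
apply/eqP; rewrite -subr_eq0; apply/negPn/negP => q0.
by have := hP (- 2 / (vdot h u - 1)); rewrite divfK //; lra.
Qed.

End Separation.

(** * A theorem of alternatives for semidefinite programs *)

Section Alternative.
Set Implicit Arguments.
Unset Strict Implicit.
Variable R : realType.

Lemma vdotZl m a (x y : 'cV[R]_m) : vdot (a *: x) y = a * vdot x y.
Proof. by rewrite /vdot trmxZ -scalemxAl mxE. Qed.

Lemma vdotC m (x y : 'cV[R]_m) : vdot x y = vdot y x.
Proof. by rewrite !vdotE; apply: eq_bigr => i _; rewrite mulrC. Qed.

Lemma mxdotDl n (S T X : 'M[R]_n) : mxdot (S + T) X = mxdot S X + mxdot T X.
Proof. by rewrite /mxdot mulmxDl mxtraceD. Qed.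

Lemma mxdotZl n a (S X : 'M[R]_n) : mxdot (a *: S) X = a * mxdot S X.
Proof. by rewrite /mxdot -scalemxAl mxtraceZ. Qed.

Lemma mxdotC n (S X : 'M[R]_n) : mxdot S X = mxdot X S.
Proof. exact: mxtrace_mulC. Qed.

Lemma mxdotDr n (S X Y : 'M[R]_n) : mxdot S (X + Y) = mxdot S X + mxdot S Y.
Proof. by rewrite mxdotC mxdotDl !(mxdotC S). Qed.

Lemma mxdotZr n a (S X : 'M[R]_n) : mxdot S (a *: X) = a * mxdot S X.
Proof. by rewrite mxdotC mxdotZl mxdotC. Qed.

Lemma mxdot0r n (S : 'M[R]_n) : mxdot S 0 = 0.
Proof. by rewrite /mxdot mulmx0 mxtrace0. Qed.

Section Operator.
Variables (m n : nat) (A : 'I_m -> 'M[R]_n).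

Lemma AopD X Y : Aop A (X + Y) = Aop A X + Aop A Y.
Proof. by apply/matrixP => i j; rewrite !mxE mxdotDr. Qed.

Lemma AopZ a X : Aop A (a *: X) = a *: Aop A X.
Proof. by apply/matrixP => i j; rewrite !mxE mxdotZr. Qed.

Lemma AadjZ a y : Aadj A (a *: y) = a *: Aadj A y.
Proof.
by rewrite /Aadj scaler_sumr; apply: eq_bigr => i _; rewrite mxE scalerA.
Qed.

Lemma mxdot_Aadj y X : mxdot (Aadj A y) X = vdot y (Aop A X).
Proof.
rewrite vdotE /mxdot /Aadj mulmx_suml linear_sum /=.
by apply: eq_bigr => i _; rewrite -scalemxAl mxtraceZ mxE.
Qed.

Lemma Aadj_sym y : (forall i, (A i)^T = A i) -> (Aadj A y)^T = Aadj A y.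
Proof.
move=> symA; rewrite /Aadj linear_sum /=.
by apply: eq_bigr => i _; rewrite trmxZ symA.
Qed.

End Operator.

Lemma psd_selfdual n (F : 'M[R]_n) :
  F^T = F -> (forall X, psd X -> 0 <= mxdot F X) -> psd F.
Proof.
move=> symF pF; split=> [|x]; first exact/symmxP.
have := pF (x *m x^T); rewrite -[x in x *m _]trmxK => /(_ (psd_gram _)).
by rewrite trmxK /mxdot mulmxA mxtrace_mulC mulmxA trace_mx11.
Qed.

Lemma affine_ge0 (a c : R) : (forall t, 0 < t -> 0 <= t * a + c) -> 0 <= a.
Proof.
move=> h; rewrite leNgt; apply/negP => a0.
have t0 : 0 < (`|c| + 1) / - a by rewrite divr_gt0 ?oppr_gt0 // ltr_pwDr.
have := h _ t0; rewrite invrN mulrN mulNr divfK ?lt_eqF //.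
by have := ler_norm c; lra.
Qed.

(** The cone of the vectors [(A X - t b, <C, X> - t v + s)] with [X] psd and
    [t, s > 0] omits [0], since otherwise [X / t] would be feasible with value
    [v - s / t < v], and the choice [X = 1, t = s = 1] gives an order unit [u].
    Let [(l, mu)] separate.  If [mu > 0], then [- l / mu] is the dual solution.
    If [mu = 0], then [A^* l] is psd; it is nonzero because the functional is
    nonzero at [u]. *)
Lemma sdp_alternative m n (A : 'I_m -> 'M[R]_n) (b : 'cV[R]_m) (C : 'M[R]_n)
    (v : R) :
  (forall i, (A i)^T = A i) -> C^T = C ->
  (exists X, primal_feasible A b X) ->
  (forall X, primal_feasible A b X -> v <= mxdot C X) ->
  (exists2 y, psd (C - Aadj A y) & v <= vdot b y) \/
  (exists y, [/\ psd (Aadj A y), Aadj A y != 0 & vdot b y = 0]).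
Proof.
move=> symA symC [X0 [AX0 pX0]] lev.
(* [t] homogenizes the constraint and [s] is the slack in the value. *)
pose L X t s : 'cV[R]_(m + 1) :=
  col_mx (Aop A X - t *: b) (mxdot C X - t * v + s)%:M.
pose K := [set z | exists X t s, [/\ psd X, 0 < t, 0 < s & z = L X t s]].
have LD X t s X' t' s' : L X t s + L X' t' s' = L (X + X') (t + t') (s + s').
  rewrite /L add_col_mx -raddfD /= AopD scalerDl mxdotDr; congr (col_mx _ _%:M).
    by rewrite addrACA opprD.
  by ring.
have LZ a X t s : a *: L X t s = L (a *: X) (a * t) (a * s).
  rewrite /L scale_col_mx scale_scalar_mx AopZ mxdotZr scalerBr scalerA.
  by congr (col_mx _ _%:M); ring.
have KD x y : K x -> K y -> K (x + y).
  move=> [X [t [s [pX t0 s0 ->]]]] [X' [t' [s' [pX' t0' s0' ->]]]].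
  exists (X + X'), (t + t'), (s + s'); split; rewrite ?LD ?addr_gt0 //.
  exact: psdD.
have KZ a x : 0 < a -> K x -> K (a *: x).
  move=> a0 [X [t [s [pX t0 s0 ->]]]].
  exists (a *: X), (a * t), (a * s); split; rewrite ?LZ ?mulr_gt0 //.
  by apply: psdZ => //; apply: ltW.
have K0 : ~ K 0.
  move=> [X [t [s [pX t0 s0]]]]; rewrite -col_mx0 => /eq_col_mx[/esym AX].
  move=> /matrixP /(_ 0 0); rewrite !mxE eqxx mulr1n => /esym CX.
  have /lev : primal_feasible A b (t^-1 *: X).
    split; last by apply: psdZ => //; rewrite invr_ge0 ltW.
    rewrite AopZ; move/eqP: AX; rewrite subr_eq0 => /eqP ->.
    by rewrite scalerA mulVf ?gt_eqF // scale1r.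
  by rewrite mxdotZr -(ler_pM2l t0) mulVKf ?gt_eqF //; lra.
pose u := L 1%:M 1 1.
have Ku : K u by exists 1%:M, 1, 1; split=> //; apply: psd_scalar.
have Ku0 a : K (a *: u) -> 0 <= a.
  move=> Kau; rewrite leNgt; apply/negP => a0; apply: K0.
  have Na0 : 0 < - a by rewrite oppr_gt0.
  by have := KD _ _ Kau (KZ _ _ Na0 Ku); rewrite -scalerDl subrr scale0r.
have Kunit y : K y -> exists t, K (t *: u - y).
  move=> [X [t [s [pX t0 s0 ->]]]].
  have [r r0 pr] := psd_scalar_sub (psd_sym pX).
  exists (r + t + s); exists ((r + t + s)%:M - X), (r + s), (r + t).
  split; [|lra|lra|].
    have -> : (r + t + s)%:M - X = (r%:M - X) + (t + s)%:M.
      by rewrite -addrA raddfD /= addrAC.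
    by apply: psdD => //; apply: psd_scalar; lra.
  rewrite /u LZ -scaleN1r LZ LD; congr (L _ _ _); [|by ring..].
  by rewrite scaleN1r scalemx1.
have [g [gK gu]] := cone_separation KD KZ Ku0 Ku Kunit.
pose l := usubmx g; pose mu := dsubmx g 0 0.
have gL X t s : vdot g (L X t s) =
    mxdot (Aadj A l + mu *: C) X - t * (vdot l b + mu * v) + mu * s.
  rewrite -[g]vsubmxK -/l [dsubmx g]mx11_scalar -/mu /vdot.
  rewrite tr_col_mx mul_row_col tr_scalar_mx mxE -scalar_mxM mulmxBr -scalemxAr.
  rewrite mxdotDl mxdotZl mxdot_Aadj /vdot.
  move: (l^T *m Aop A X) (l^T *m b) => h1 h2.
  by rewrite !mxE eqxx mulr1n; ring.
have gP X t s : psd X -> 0 < t -> 0 < s ->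
    0 <= mxdot (Aadj A l + mu *: C) X - t * (vdot l b + mu * v) + mu * s.
  by move=> pX t0 s0; rewrite -gL; apply: gK; exists X, t, s.
set F := Aadj A l + mu *: C in gL gP.
have mu0 : 0 <= mu.
  apply: (@affine_ge0 _ (- (vdot l b + mu * v))) => s s0.
  by have := gP 0 1 s (psd0 _ _) ltr01 s0; rewrite mxdot0r; lra.
have lb : 0 <= - (vdot l b + mu * v).
  apply: (@affine_ge0 _ mu) => t t0.
  by have := gP 0 t 1 (psd0 _ _) t0 ltr01; rewrite mxdot0r; lra.
have pF : psd F.
  apply: psd_selfdual => [|X pX].
    by rewrite trmxD trmxZ symC Aadj_sym.
  apply: (@affine_ge0 _ (- (vdot l b + mu * v) + mu)) => t t0.
  have := gP (t *: X) 1 1 (psdZ (ltW t0) pX) ltr01 ltr01; rewrite mxdotZr; lra.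
move: mu0; rewrite le_eqVlt => /orP[/eqP mu0|mu_gt0]; [right|left].
  have FE : F = Aadj A l by rewrite /F -mu0 scale0r addr0.
  have bl0 : vdot b l = 0.
    have := psd_mxdot_ge0 pF pX0; rewrite FE mxdot_Aadj AX0 vdotC.
    by move: lb; rewrite -mu0 mul0r addr0 vdotC; lra.
  exists l; rewrite -FE; split=> //; apply/eqP => F0.
  move: gu; rewrite /u gL F0 -mu0 mxdotC mxdot0r (vdotC l) bl0; lra.
exists (- mu^-1 *: l).
  have -> : C - Aadj A (- mu^-1 *: l) = mu^-1 *: F.
    rewrite AadjZ scaleNr opprK /F scalerDr scalerA mulVf ?gt_eqF // scale1r.
    by rewrite addrC.
  by apply: psdZ => //; rewrite invr_ge0 ltW.
rewrite vdotC vdotZl mulNr -(ler_pM2l mu_gt0) mulrN mulVKf ?gt_eqF //.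
by lra.
Qed.

End Alternative.

(** * Faces and tangent sets *)

Section Faces.
Set Implicit Arguments.
Unset Strict Implicit.
Variables (R : realType) (n : nat).
Implicit Types U V P M T X D : 'M[R]_n.

(** For [U] psd these conditions say that [P] is the orthogonal projector onto
    the kernel of [U]; the last one says that [1 - P] maps into the range of
    [U], which is what membership in [tan U] requires of [W]. *)
Definition ker_projector U P :=
  [/\ P^T = P, P *m P = P, U *m P = 0 & exists Z, 1%:M - P = U *m Z].

(** If the rows of [B] form a basis of the kernel, then
    [P = B^T (B B^T)^-1 B]. *)
Lemma ker_projector_ex U : U^T = U -> exists P, ker_projector U P.
Proof.
move=> symU.
have [r [B [freeB BE]]] :
    exists r (B : 'M[R]_(r, n)), row_free B /\ (B :=: kermx U)%MS.
  exists _, (row_base (kermx U)).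
  by split; [exact: row_base_free|exact: eq_row_base].
have BU : B *m U = 0.
  by apply/eqP; rewrite -sub_kermx BE.
have UBT : U *m B^T = 0 by rewrite -[LHS]trmxK trmx_mul trmxK symU BU trmx0.
have uBB : B *m B^T \in unitmx.
  rewrite -row_free_unit -kermx_eq0.
  set k := kermx (_ *m _); have kBB : k *m (B *m B^T) = 0 by rewrite mulmx_ker.
  have /trmul_eq0 : ((k *m B)^T)^T *m (k *m B)^T = 0.
    by rewrite trmxK trmx_mul -mulmxA (mulmxA B) mulmxA kBB mul0mx.
  move=> /(congr1 trmx); rewrite trmxK trmx0 => /eqP.
  by rewrite mulmx_free_eq0.
pose G := invmx (B *m B^T); pose P := B^T *m G *m B.
have symG : G^T = G by rewrite /G trmx_inv trmx_mul trmxK.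
have PBT : P *m B^T = B^T by rewrite /P -!mulmxA mulVmx ?mulmx1.
have symP : P^T = P by rewrite /P !trmx_mul trmxK symG mulmxA.
exists P; split=> //.
- by rewrite [X in _ *m X](_ : P = B^T *m G *m B) // !mulmxA PBT.
- by rewrite /P -!mulmxA mulmxA UBT mul0mx.
have /submxP[E cE] : ((cokermx U)^T <= B)%MS.
  rewrite BE sub_kermx -{2}symU -trmx_mul mulmx_coker trmx0 //.
have /submxP[D DE] : (1%:M - P <= U)%MS.
  rewrite submxE -[cokermx U]trmxK cE trmx_mul mulmxA mulmxBl mul1mx PBT.
  by rewrite subrr mul0mx.
exists D^T; rewrite -[LHS]trmxK trmxB trmx1 symP DE trmx_mul symU //.
Qed.

Lemma tan_psd_sym U T : tan_psd U T -> T^T = T.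
Proof. by case=> W _ <-; rewrite trmxD trmxK addrC. Qed.

(** A Gram factor [G = (G1 G2)] of the block matrix gives [U = G1^T G1] and
    [W = G1^T G2], so that [U X = 0] forces [G1 X = 0] and [W^T X = 0]. *)
Lemma tan_psd_mxdot0 U T X :
  tan_psd U T -> psd X -> U *m X = 0 -> mxdot T X = 0.
Proof.
move=> [W [R0 _ /psd_gramP[p [G GE]]] <-] pX UX.
have symX := psd_sym pX.
move: GE; rewrite -[G]hsubmxK; set G1 := lsubmx G; set G2 := rsubmx G.
rewrite tr_row_mx mul_col_row => /eq_block_mx[UE WE WE' _].
have G1X : G1 *m X = 0.
  apply: trmul_eq0.
  by rewrite trmx_mul mulmxA -(mulmxA X^T) -UE -mulmxA UX mulmx0.
have WX : W^T *m X = 0 by rewrite WE' -mulmxA G1X mulmx0.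
rewrite mxdotDl /mxdot WX mxtrace0 addr0 -mxtrace_tr trmx_mul symX.
by rewrite mxtrace_mulC WX mxtrace0.
Qed.

(** Writing [Q = 1 - P], a symmetric [T] with [P T P = 0] equals
    [W + W^T] for [W = Q T (P + Q / 2)], whose range lies in that of [U]. *)
Lemma tan_psd_compression U P T :
  psd U -> ker_projector U P -> T^T = T -> P *m T *m P = 0 -> tan_psd U T.
Proof.
move=> pU [symP PP UP [Z QZ]] symT PTP.
pose Y := Z *m T *m (P + 2^-1 *: (1%:M - P)).
exists (U *m Y); last first.
  have -> : U *m Y = T *m P + 2^-1 *: (T - T *m P - P *m T).
    have SP : (T - P *m T) *m P = T *m P by rewrite mulmxBl PTP subr0.
    rewrite /Y !mulmxA -QZ mulmxBl mul1mx mulmxDr -scalemxAr mulmxBr mulmx1 SP.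
    by rewrite addrAC.
  rewrite trmxD trmxZ !trmxB !trmx_mul symP symT addrACA -scalerDr.
  rewrite -[T - P *m T - _]addrAC -mulr2n -scaler_nat scalerA.
  by rewrite mulVf ?pnatr_eq0 // scale1r -[X in _ + X]addrA -opprD addrC subrK.
exists (Y^T *m U *m Y); first exact: psd_congr.
have := psd_congr (row_mx 1%:M Y) pU; congr psd.
rewrite tr_row_mx trmx1 mul_col_mx mul_col_row !mul1mx !mulmx1.
by rewrite [(U *m Y)^T]trmx_mul (psd_sym pU).
Qed.

Lemma psd_add_tan_compression U P M :
  psd U -> ker_projector U P -> M^T = M -> psd (P *m M *m P) ->
  [set S + T | S in @psd R n & T in tan_psd U] M.
Proof.
move=> pU kP symM pM; have [symP PP _ _] := kP.
exists (P *m M *m P) => //.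
exists (M - P *m M *m P); last by rewrite addrC subrK.
apply: (tan_psd_compression pU kP) => //.
  by rewrite trmxB !trmx_mul symP symM mulmxA.
by rewrite mulmxBr mulmxBl -!mulmxA PP !mulmxA PP subrr.
Qed.

(** The new kernel is [ker D] cut with the old one, strictly smaller since
    [D] is nonzero. *)
Lemma rank_face_step U P D :
  ker_projector U P -> D != 0 -> P *m D = D -> D *m P = D ->
  (\rank U < \rank (D + (1%:M - P))%R)%N.
Proof.
move=> [symP PP UP _] D0 PD DP; apply: rank_ltmx.
have QU' : (1%:M - P) *m (D + (1%:M - P)) = 1%:M - P.
  rewrite mulmxDr !mulmxBl !mulmxBr !mul1mx mulmx1 PD PP subrr add0r.
  by rewrite subrr subr0.
have UE : U *m (1%:M - P) *m (D + (1%:M - P)) = U.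
  by rewrite -mulmxA QU' mulmxBr mulmx1 UP subr0.
rewrite /ltmx -{1}UE submxMl /=.
apply: contra D0 => /submxP[E /(congr1 (mulmx^~ P))].
rewrite mulmxDl mulmxBl mul1mx PP subrr addr0 DP -mulmxA UP mulmx0 => ->.
exact: eqxx.
Qed.

Lemma psd_compl_projector U P : ker_projector U P -> psd (1%:M - P).
Proof.
move=> [symP PP _ _]; rewrite (_ : 1%:M - P = (1%:M - P)^T *m (1%:M - P)).
  exact: psd_gram.
by rewrite trmxB trmx1 symP mulmxBr mulmx1 mulmxBl mul1mx PP subrr subr0.
Qed.

End Faces.

(** * Facial reduction *)

Section FacialReduction.
Set Implicit Arguments.
Unset Strict Implicit.
Variables (R : realType) (m n : nat) (A : 'I_m -> 'M[R]_n.+1) (b : 'cV[R]_m).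

Definition link U (y : 'cV[R]_m) U' V :=
  [/\ Aadj A y = U' + V, vdot b y = 0, psd U' & tan_psd U V].

(** Only the last [U] matters for [C - A^* y], so the sequences of the dual
    problem are forgotten; [chain_seq] recovers them. *)
Inductive chain : nat -> 'M[R]_n.+1 -> Prop :=
| chain0 : chain 0 0
| chainS k U y U' V : chain k U -> link U y U' V -> chain k.+1 U'.

Lemma chain_psd k U : chain k U -> psd U.
Proof. by case=> [|k' U0 y U' V _ []] //; exact: psd0. Qed.

(** Each [U_k] exposes a face of the psd cone containing every primal feasible
    [X]: as [V_k] pairs to zero with [X], [<U_k, X> = <b, y^k> = 0]. *)
Lemma chain_annihilates k U X :
  chain k U -> primal_feasible A b X -> U *m X = 0.
Proof.
move=> cU [AX pX]; elim: cU => [|k' U0 y U' V _ IH [Ay by0 pU' tV]].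
  by rewrite mul0mx.
apply: psd_mxdot_eq0 => //.
have := mxdot_Aadj A y X; rewrite Ay AX vdotC by0 mxdotDl.
by rewrite (tan_psd_mxdot0 tV pX IH) addr0.
Qed.

Lemma certificate_bound k U y C X :
  chain k U -> primal_feasible A b X ->
  [set S + T | S in @psd R n.+1 & T in tan_psd U] (C - Aadj A y) ->
  vdot b y <= mxdot C X.
Proof.
move=> cU fX [S pS [T tT STE]]; have [AX pX] := fX.
rewrite -subr_ge0 vdotC -AX -mxdot_Aadj -mulN1r -mxdotZl scaleN1r -mxdotDl -STE.
rewrite mxdotDl (tan_psd_mxdot0 tT pX (chain_annihilates cU fX)) addr0.
exact: psd_mxdot_ge0.
Qed.

Lemma chain_seq k U : chain k U ->
  exists (ys : nat -> 'cV[R]_m) (Us Vs : nat -> 'M[R]_n.+1),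
    [/\ Us 0%N = 0, Vs 0%N = 0, Us k = U &
        forall i, (i < k)%N -> link (Us i) (ys i) (Us i.+1) (Vs i.+1)].
Proof.
elim=> [|k' U0 y U' V _ [ys [Us [Vs [U0E V0E UkE lk]]]] l'].
  by exists (fun=> 0), (fun=> 0), (fun=> 0).
exists (fun i => if i == k' then y else ys i),
  (fun i => if i == k'.+1 then U' else Us i),
  (fun i => if i == k'.+1 then V else Vs i).
split; rewrite ?eqxx // => i; rewrite ltnS leq_eqVlt => /predU1P[->|ik].
  by rewrite !eqxx (ltn_eqF (ltnSn k')) UkE.
by rewrite eqSS (ltn_eqF ik) (ltn_eqF (ltnW _)) //; exact: lk.
Qed.

(** The dual has exactly [n] steps, so a shorter reduction is prolonged by
    [y = 0], [U' = U] and [V = - U], which is in [tan U] as [P U P = 0]. *)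
Lemma chain_pad k U : chain k U -> chain k.+1 U.
Proof.
move=> cU; have pU := chain_psd cU; have symU := psd_sym pU.
have [P kP] := ker_projector_ex symU.
apply: (@chainS _ _ 0 _ (- U) cU); split=> //.
- by rewrite subrr /Aadj big1 // => i _; rewrite mxE scale0r.
- by rewrite /vdot mulmx0 mxE.
apply: (tan_psd_compression pU kP) => //.
  by rewrite -scaleN1r trmxZ symU.
by case: kP => _ _ UP _; rewrite mulmxN mulNmx -mulmxA UP mulmx0 oppr0.
Qed.

Section Value.
Variables (C : 'M[R]_n.+1) (v : R).
Hypothesis symA : forall i, (A i)^T = A i.
Hypothesis symC : C^T = C.
Hypothesis feasP : exists X, primal_feasible A b X.
Hypothesis lev : forall X, primal_feasible A b X -> v <= mxdot C X.

Let certified k := exists U y, [/\ chain k U,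
  [set S + T | S in @psd R n.+1 & T in tan_psd U] (C - Aadj A y) &
  v <= vdot b y].

(** The theorem of alternatives for the data compressed by [P].  Since
    [<P M P, X> = <M, P X P>], a psd [X] is feasible for the compressed program
    if and only if [P X P] is feasible for the original one, where it has the
    same value; and feasible [X] exist because those of the original program
    satisfy [P X P = X]. *)
Lemma certified_or_direction k U P :
  chain k U -> ker_projector U P ->
  certified k \/
  exists y, [/\ psd (P *m Aadj A y *m P), P *m Aadj A y *m P != 0
              & vdot b y = 0].
Proof.
move=> cU kP; have [symP PP UP [Z QZ]] := kP.
have symPMP M : M^T = M -> (P *m M *m P)^T = P *m M *m P.
  by move=> sM; rewrite !trmx_mul symP sM mulmxA.
pose A' i := P *m A i *m P.
have mxdotP M X : mxdot (P *m M *m P) X = mxdot M (P *m X *m P).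
  by rewrite /mxdot -mulmxA -mulmxA mxtrace_mulC !mulmxA.
have AadjP y : Aadj A' y = P *m Aadj A y *m P.
  rewrite /Aadj mulmx_sumr mulmx_suml; apply: eq_bigr => i _.
  by rewrite -scalemxAr -scalemxAl.
have AopP X : Aop A' X = Aop A (P *m X *m P).
  by apply/matrixP => i j; rewrite !mxE mxdotP.
have PXP X : primal_feasible A b X -> P *m X *m P = X.
  move=> fX; have UX := chain_annihilates cU fX.
  have symX : X^T = X by case: fX => _ /psd_sym.
  have PX : P *m X = X.
    have : (1%:M - P) *m X = 0.
      rewrite -[1%:M - P]trmxK trmxB trmx1 symP QZ trmx_mul.
      by rewrite (psd_sym (chain_psd cU)) -mulmxA UX mulmx0.
    by rewrite mulmxBl mul1mx => /eqP; rewrite subr_eq0 => /eqP <-.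
  by rewrite PX -[LHS]trmxK trmx_mul symX symP PX.
have fP X : primal_feasible A' b X -> primal_feasible A b (P *m X *m P).
  by move=> [AX pX]; split; rewrite -?AopP // -{1}symP; exact: psd_congr.
have [|||X /fP /lev|[y pDy vy]|] :=
  @sdp_alternative R m n.+1 A' b (P *m C *m P) v.
- by move=> i; rewrite symPMP.
- exact: symPMP.
- have [X fX] := feasP; exists X; split; last by case: fX.
  by rewrite AopP PXP //; case: fX.
- by rewrite mxdotP.
- left; exists U, y; split=> //.
  apply: (psd_add_tan_compression (chain_psd cU) kP).
    by rewrite trmxB symC Aadj_sym.
  by rewrite mulmxBr mulmxBl -AadjP.
by move=> [y]; rewrite AadjP => dy; right; exists y.
Qed.

(** The matrix [V = A^* y - U'] is in [tan U] because [P V P = D - P U' P = 0].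
    The summand [1 - P] keeps the new kernel inside the old one. *)
Lemma direction_chainS k U P y :
  chain k U -> ker_projector U P -> psd (P *m Aadj A y *m P) ->
  vdot b y = 0 -> chain k.+1 (P *m Aadj A y *m P + (1%:M - P)).
Proof.
move=> cU kP pD by0; have [symP PP UP _] := kP.
set D := P *m _ *m P; set U' := D + _.
have pU' : psd U' by apply: psdD => //; exact: psd_compl_projector kP.
apply: (@chainS _ _ y _ (Aadj A y - U') cU); split=> //.
  by rewrite addrC subrK.
apply: (tan_psd_compression (chain_psd cU) kP).
  by rewrite trmxB Aadj_sym // psd_sym.
rewrite mulmxBr mulmxBl /U' mulmxDr mulmxDl mulmxBr mulmx1 PP subrr mul0mx.
by rewrite addr0 /D -!mulmxA PP !mulmxA PP subrr.
Qed.

(** Every direction raises the rank of [U], and a certificate found early is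
    carried along by padding. *)
Lemma certified_or_rank k :
  certified k \/ exists2 U, chain k U & (k <= \rank U)%N.
Proof.
elim: k => [|k [[U [y [cU CU vy]]]|[U cU rU]]].
- by right; exists 0 => //; exact: chain0.
- by left; exists U, y; split=> //; exact: chain_pad.
have [P kP] := ker_projector_ex (psd_sym (chain_psd cU)).
have [[U' [y [cU' CU vy]]]|[y [pD D0 by0]]] := certified_or_direction cU kP.
  by left; exists U', y; split=> //; exact: chain_pad.
right; exists (P *m Aadj A y *m P + (1%:M - P)).
  exact: direction_chainS cU kP pD by0.
apply: leq_ltn_trans rU _; apply: (rank_face_step kP D0); have [_ PP _ _] := kP.
  by rewrite !mulmxA PP.
by rewrite -!mulmxA PP.
Qed.

(** If the face is not yet certified after [n] steps, it is at most a ray, and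
    one further direction [y] reduces it to [0].  Then [0] is the only feasible
    matrix, so [v <= 0], while [- t y] has value [0] and is dual feasible on the
    ray for large [t], because the new [U'] is positive definite. *)
Lemma certified_at_order : certified n.
Proof.
have [//|[U cU rU]] := certified_or_rank n.
have [P kP] := ker_projector_ex (psd_sym (chain_psd cU)).
have [//|[y [pD D0 by0]]] := certified_or_direction cU kP.
have [symP PP _ _] := kP; set D := P *m Aadj A y *m P in pD D0.
have PD : P *m D = D by rewrite /D !mulmxA PP.
have DP : D *m P = D by rewrite /D -!mulmxA PP.
have cU' := direction_chainS cU kP pD by0.
have rU' := leq_ltn_trans rU (rank_face_step kP D0 PD DP).
set U' := _ + _ in cU' rU'; have pU' := chain_psd cU'.
have uU' : U' \in unitmx.
  by rewrite -row_full_unit /row_full eqn_leq rank_leq_col.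
have v0 : v <= 0.
  have [X fX] := feasP; have UX := chain_annihilates cU' fX.
  have X0 : X = 0 by rewrite -(mulKmx uU' X) UX mulmx0.
  by have := lev fX; rewrite X0 mxdot0r.
have symNC : (- C)^T = - C by rewrite -scaleN1r trmxZ symC.
have [t pt] := psd_unit_dominates pU' uU' symNC.
exists U, (- t *: y); split=> //; last first.
  by rewrite vdotC vdotZl vdotC by0 mulr0.
apply: (psd_add_tan_compression (chain_psd cU) kP).
  by rewrite trmxB symC Aadj_sym.
have PUP : P *m U' *m P = D.
  by rewrite mulmxDr mulmxDl mulmxBr mulmx1 PP subrr mul0mx addr0 PD DP.
have := psd_congr P pt; congr psd; rewrite symP AadjZ scaleNr !opprK.
by rewrite 2!mulmxDr 2!mulmxDl -!(scalemxAr, scalemxAl) PUP addrC.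
Qed.

End Value.
End FacialReduction.

(** * Chains and the Ramana dual *)

Lemma ramana_feasible_chain (R : realType) (m n : nat) (A : 'I_m -> 'M[R]_n.+1)
    (b : 'cV[R]_m) (C : 'M[R]_n.+1) y ys U V :
  ramana_feasible A b C y ys U V -> chain A b n (U ord_max).
Proof.
move=> [_ _ [U0 _] lk].
suff h k (lt_kn : (k < n.+1)%N) : chain A b k (U (Ordinal lt_kn)).
  by rewrite (_ : ord_max = Ordinal (ltnSn n)) //; apply: val_inj.
elim: k lt_kn => [|k IH] lt_kn.
  rewrite (_ : Ordinal _ = ord0) ?U0; [exact: chain0|exact: val_inj].
have lt_k : (k < n)%N by [].
have := lk (Ordinal lt_k).
rewrite (_ : lift ord0 _ = Ordinal lt_kn); last exact: val_inj.
rewrite (_ : widen_ord _ _ = Ordinal (ltnW lt_kn)); last exact: val_inj.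
by apply: chainS.
Qed.

Lemma chain_ramana_feasible (R : realType) (m n : nat) (A : 'I_m -> 'M[R]_n.+1)
    (b : 'cV[R]_m) (C : 'M[R]_n.+1) y U :
  chain A b n U ->
  [set S + T | S in @psd R n.+1 & T in tan_psd U] (C - Aadj A y) ->
  exists ys Us Vs, ramana_feasible A b C y ys Us Vs.
Proof.
move=> /chain_seq[ys [Us [Vs [U0 V0 UnE lk]]]] CU.
exists (fun i => ys i), (fun i => Us i), (fun i => Vs i); split=> //.
- case=> [[|i] lt_i] /=.
    by rewrite U0 V0; split; apply/symmxP; rewrite trmx0.
  have [_ _ [] // symU _ /tan_psd_sym tV] := lk i lt_i.
  by split; last exact/symmxP.
- by rewrite /= UnE.
by move=> i; have := lk i (ltn_ord i).
Qed.

Theorem theorem1 (R : realType) (m n : nat) (A : 'I_m -> 'M[R]_n.+1)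
    (C : 'M[R]_n.+1) (b : 'cV[R]_m)
    (symA : forall i, A i \is symmetricmx)
    (symC : C \is symmetricmx)
    (feasP : exists X, primal_feasible A b X) :
  primal_value A b C = ramana_value A b C /\
  (ramana_value A b C \is a fin_num ->
   exists y ys U V, ramana_feasible A b C y ys U V /\
     (vdot b y)%:E = ramana_value A b C).
Proof.
have {}symA i : (A i)^T = A i by apply/symmxP.
have {}symC : C^T = C by apply/symmxP.
have weak y ys U V X : ramana_feasible A b C y ys U V ->
    primal_feasible A b X -> vdot b y <= mxdot C X.
  move=> fD fX; apply: (certificate_bound (ramana_feasible_chain fD) fX).
  by case: fD.
have le_DP : (ramana_value A b C <= primal_value A b C)%E.
  apply/ereal_supP => _ [y [ys [U [V fD]]] <-].
  apply/ereal_infP => _ [X fX <-].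
  by rewrite lee_fin; apply: weak fD fX.
have le_PX X : primal_feasible A b X ->
    (primal_value A b C <= (mxdot C X)%:E)%E.
  by move=> fX; apply: ereal_inf_lbound; exists X.
case vE : (primal_value A b C) le_DP le_PX => [v| |] le_DP le_PX.
- have lev X : primal_feasible A b X -> v <= mxdot C X.
    by move=> /le_PX; rewrite lee_fin.
  have [U [y [cU CU vy]]] := certified_at_order symA symC feasP lev.
  have [ys [Us [Vs fD]]] := chain_ramana_feasible cU CU.
  have le_yD : ((vdot b y)%:E <= ramana_value A b C)%E.
    by apply: ereal_sup_ubound; exists y => //; exists ys, Us, Vs.
  have DE : ramana_value A b C = v%:E.
    apply/eqP; rewrite eq_le le_DP /=; apply: le_trans le_yD.
    by rewrite lee_fin.
  split=> // _; exists y, ys, Us, Vs; split=> //.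
  by apply/eqP; rewrite eq_le le_yD DE lee_fin.
- by have [X /le_PX] := feasP; rewrite leye_eq.
by move: le_DP; rewrite leeNy_eq => /eqP ->.
Qed.
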